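(* Let $n,k\ge 1$ be integers such that $n=3k+\ell$ with $\ell\in\{1,2\}$. Let $C_n=(V,\sigma,\mu)$ be a fuzzy cycle with $n$ vertices, represented as $C_n:u_1,u_2,\ldots,u_n,u_1$, of size $q$, with at least two edges of minimum weight. Then $$\gamma_{snR}(C_n)=\left(1-\frac{k}{n}\right)\left(q-(\mu_{\max}-\mu_{\min})\right)$$ if and only if at least $n-1$ edges have weight equal to $\mu_{\min}$ and at most one edge has weight equal to $\mu_{\max}$ (that is, all edges, except possibly one of weight $\mu_{\max}$, have weight $\mu_{\min}$).
   Context: A fuzzy graph $G=(V,\sigma,\mu)$ consists of a finite nonempty set $V$, a function $\sigma:V\to[0,1]$, and a symmetric function $\mu:V\times V\to[0,1]$ with $\mu(x,x)=0$ and $\mu(x,y)\le \min\{\sigma(x),\sigma(y)\}$ for all $x,y\in V$. An edge is an unordered pair $(u,v)$ of distinct vertices with $\mu(u,v)>0$, and $\mu(u,v)$ is its weight. The size $q$ is the sum of the weights of all edges, each edge counted once. The strength of a path $x_0,x_1,\ldots,x_m$ (with every $\mu(x_{i-1},x_i)>0$) is $\min_i \mu(x_{i-1},x_i)$, and $CONN_G(u,v)$ is the maximum strength of all $u$–$v$ paths. An edge $(u,v)$ is strong if $\mu(u,v)=CONN_G(u,v)$; then $u,v$ are strong neighbors. $N_s(u)$ is the set of strong neighbors of $u$, and $\mu_s(u)=\min\{\mu(u,v):v\in N_s(u)\}$. $\mu_{\min}$ and $\mu_{\max}$ are the minimum and maximum weight of a strong edge. A fuzzy cycle $C_n:u_1,\ldots,u_n,u_1$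 ($n\ge3$) is a fuzzy graph with vertex set $V=\{u_1,\ldots,u_n\}$ ($n$ distinct vertices) whose edges are exactly $(u_i,u_{i+1})$ for $1\le i\le n-1$ and $(u_n,u_1)$. A strong-neighbors Roman dominating function (SNRDF) on $G$ is a function $f:V\to\{0,1,2\}$ such that every $u$ with $f(u)=0$ has some $v\in N_s(u)$ with $f(v)=2$. Its weight is $w(f)=\sum_{u\in V}f(u)\mu_s(u)$, and $\gamma_{snR}(G)$ is the minimum weight of an SNRDF on $G$. *)

(* Defs.v *)
From mathcomp Require Import all_boot all_order all_algebra.

Set Implicit Arguments.
Unset Strict Implicit.
Unset Printing Implicit Defensive.

Import Order.TTheory GRing.Theory Num.Theory.
Local Open Scope ring_scope.

Record fuzzyGraph (R : realFieldType) (V : finType) := FuzzyGraph {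
  fg_sigma : V -> R;
  fg_mu : V -> V -> R;
  fg_nonempty : (0 < #|V|)%N;
  fg_sigma01 : forall x, 0 <= fg_sigma x <= 1;
  fg_mu01 : forall x y, 0 <= fg_mu x y <= 1;
  fg_mu_sym : forall x y, fg_mu x y = fg_mu y x;
  fg_mu_diag : forall x, fg_mu x x = 0;
  fg_mu_le : forall x y, fg_mu x y <= Num.min (fg_sigma x) (fg_sigma y)
}.

Section FuzzyGraph.
Variables (R : realFieldType) (V : finType) (G : fuzzyGraph R V).
Local Notation mu := (fg_mu G).

Definition edges : {set {set V}} :=
  [set e | [exists x, exists y,
     [&& x != y, 0 < mu x y & e == [set x; y]]]].

(* The endpoints are picked in an arbitrary order, which is irrelevant since
   mu is symmetric: see edge_weightE. *)
Definition edge_weight (e : {set V}) : R :=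
  if [pick p : V * V | e == [set p.1; p.2]] is Some p then mu p.1 p.2 else 0.

Lemma edge_weightE x y : edge_weight [set x; y] = mu x y.
Proof.
rewrite /edge_weight; case: pickP => [[a b] /= /eqP E|/(_ (x, y))]; last first.
  by rewrite /= eqxx.
have: (a \in [set x; y]) && (b \in [set x; y]) by rewrite E !inE !eqxx orbT.
have: (x \in [set a; b]) && (y \in [set a; b]) by rewrite -E !inE !eqxx orbT.
rewrite !inE => /andP[/orP[]/eqP xE /orP[]/eqP yE].
- by rewrite xE yE !orbb => /andP[_ /eqP->].
- by rewrite xE yE.
- by rewrite xE yE fg_mu_sym.
- by rewrite xE yE !orbb => /andP[/eqP-> _].
Qed.

Definition fg_size : R := \sum_(e in edges) edge_weight e.

Definition min_weight_edges : {set {set V}} :=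
  [set e in edges | [forall e' in edges, edge_weight e <= edge_weight e']].

Definition fg_path (x y : V) (p : seq V) : bool :=
  [&& path (fun a b => 0 < mu a b) x p, uniq (x :: p) & last x p == y].

(* Weights lie in [0, 1], so the default value 1 is only visible on the path of
   length 0, which never joins the two ends of an edge. *)
Definition strength (x : V) (p : seq V) : R :=
  \big[Num.min/1]_(w <- pairmap mu x p) w.

(* A path x :: p without repetition has size p < #|V|; strengths are positive,
   so the default value 0 is reached only when no path exists. *)
Definition conn (x y : V) : R :=
  \big[Num.max/0]_(m < #|V|)
    \big[Num.max/0]_(p : m.-tuple V | fg_path x y p) strength x p.

Lemma conn_ub x y p : fg_path x y p -> strength x p <= conn x y.
Proof.
move=> xpy; have /and3P[_ uxp _] := xpy.
have ltpV : (size p < #|V|)%N.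
  by have := max_card [in x :: p]; rewrite (card_uniqP uxp).
pose F (m : 'I_#|V|) :=
  \big[Num.max/0]_(q : m.-tuple V | fg_path x y q) strength x q.
apply: (@le_trans _ _ (F (Ordinal ltpV))); last exact: le_bigmax.
exact: (@le_bigmax_cond _ _ _ 0 (in_tuple p)
  (fun q : (size p).-tuple V => fg_path x y q) (fun q => strength x q)).
Qed.

Lemma conn_attained x y : 0 < conn x y ->
  exists2 p, fg_path x y p & strength x p = conn x y.
Proof.
rewrite /conn.
have K (c d : R) (P : R -> Prop) :
    (0 < c -> P c) -> (0 < d -> P d) -> 0 < Num.max c d -> P (Num.max c d).
  by case: (leP c d).
pose P c := 0 < c -> exists2 p, fg_path x y p & strength x p = c.
apply: (big_ind P) => [|c d|m _]; first by rewrite /P ltxx.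
  exact: (@K c d (fun c => exists2 p, fg_path x y p & strength x p = c)).
apply: (big_ind P) => [|c d|p xpy _]; first by rewrite /P ltxx.
  exact: (@K c d (fun c => exists2 p, fg_path x y p & strength x p = c)).
by exists p.
Qed.

Definition strong (x y : V) : bool := (0 < mu x y) && (mu x y == conn x y).

Definition strong_nbrs (x : V) : {set V} := [set y | strong x y].

(* The value 1 for a minimum over the empty set occurs only at isolated
   vertices. *)
Definition mu_s (x : V) : R := \big[Num.min/1]_(y in strong_nbrs x) mu x y.

Definition strong_edges : {set {set V}} :=
  [set e | [exists x, exists y, strong x y && (e == [set x; y])]].

Definition mu_min : R := \big[Num.min/1]_(e in strong_edges) edge_weight e.
Definition mu_max : R := \big[Num.max/0]_(e in strong_edges) edge_weight e.

Definition snrdf (f : {ffun V -> 'I_3}) : bool :=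
  [forall x, (f x == 0 :> nat) ==>
     [exists y in strong_nbrs x, f y == 2 :> nat]].

Definition snrdf_weight (f : {ffun V -> 'I_3}) : R :=
  \sum_x (f x)%:R * mu_s x.

(* The minimum is over a nonempty set: the constant function 2 is an SNRDF. *)
Definition gamma_snR : R :=
  snrdf_weight
    [arg min_(f < [ffun=> (ord_max : 'I_3)] | snrdf f) snrdf_weight f]%O.

Lemma snrdf_const2 : snrdf [ffun=> (ord_max : 'I_3)].
Proof. by apply/forallP => x; rewrite ffunE. Qed.

(* Vertices are indexed by 0, ..., n-1, and ordS is the cyclic successor. *)
Definition fuzzy_cycle (n : nat) (u : 'I_n -> V) : Prop :=
  [/\ (3 <= n)%N, bijective u &
      edges = [set [set u i; u (ordS i)] | i : 'I_n]].

End FuzzyGraph.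

(* Main.v *)
Require Import Defs.
From mathcomp Require Import all_boot all_order all_algebra.
From mathcomp Require Import zify ring lra.

Set Implicit Arguments.
Unset Strict Implicit.
Unset Printing Implicit Defensive.

Import Order.TTheory GRing.Theory Num.Theory.
Local Open Scope ring_scope.

(* Index the cycle by Z/n, let w i be the weight of the edge (i, i+1), and write
   m and M for the extreme weights. Because two edges have weight m, every edge
   is strong: an edge and a lightest edge other than it form a cut. Hence
   mu_s i = min (w i) (w (i-1)), and the sum S of mu_s is at most q - (M - m),
   by telescoping the increases of w from a lightest to a heaviest edge.
   The word (0 2 0)^k 1^l is Roman dominating of total value n - k; averaging
   its rotations gives n gamma <= (n - k) S <= (n - k) (q - (M - m)).
   If the two ends agree then all rotations of all words of total value n - k
   have the same weight, which forces mu_s to be constant, hence equal to m; then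
   n m = q - (M - m) leaves a single edge heavier than m. Conversely, if mu_s is
   constant then gamma = (n - k) m, as the Roman domination number of the n-cycle
   is n - k. *)

(** * Indices modulo n and Roman domination of the n-cycle *)

Section CyclicIndices.
Variable p : nat.
Local Notation Z := 'I_p.+3.

Lemma ordS_add1 (i : Z) : ordS i = i + 1.
Proof. by apply: val_inj; rewrite /= modnDmr addn1. Qed.

Lemma val_add1 (i : Z) : (i.+1 < p.+3)%N -> (i + 1 : Z) = i.+1 :> nat.
Proof. by move=> lti; rewrite /= modnDmr addn1 modn_small. Qed.

Lemma val_add1_if (i : Z) :
  (i + 1 : Z) = (if (i.+1 < p.+3)%N then i.+1 else 0%N) :> nat.
Proof.
case: ifP => lt1; first exact: val_add1.
have lti := ltn_ord i; have -> : i = ord_max by apply: val_inj => /=; lia.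
by rewrite /= modnDmr addn1 modnn.
Qed.

Lemma val_sub1 (i : Z) : (0 < i)%N -> (i - 1 : Z) = i.-1 :> nat.
Proof.
move=> i0; have lti := ltn_ord i.
have lt1 : (i.-1.+1 < p.+3)%N by lia.
suff -> : i - 1 = Ordinal (ltnW lt1) by [].
apply/(addIr 1); rewrite subrK; apply: ord_inj.
by rewrite val_add1 //= prednK.
Qed.

Lemma cycle_natr : (p.+3)%:R = 0 :> Z.
Proof. by apply: val_inj; rewrite Zp_nat /= modnn. Qed.

Lemma cycle_const (T : Type) (s : Z -> T) :
  (forall i, s (i + 1) = s i) -> forall i j, s i = s j.
Proof.
move=> sS; suff s0 i : s i = s 0 by move=> i j; rewrite !s0.
by rewrite -[i]natr_Zp; elim: (val i) => // m IHm; rewrite -natr1 sS.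
Qed.

Lemma sum_natr (A : nmodType) (F : Z -> A) :
  \sum_i F i = \sum_(0 <= t < p.+3) F t%:R.
Proof. by rewrite big_mkord; apply: eq_bigr => i _; rewrite natr_Zp. Qed.

(** Natural-valued, so that sums and rotations stay free of casts; the bound 2 on values is imposed
    separately. *)
Definition roman_dom (f : Z -> nat) : Prop :=
  forall i, f i = 0%N -> f (i + 1) = 2%N \/ f (i - 1) = 2%N.

Lemma roman_dom_shift f j : roman_dom f -> roman_dom (fun i => f (i - j)).
Proof.
move=> fP i /fP[] <-; [left|right]; congr f; ring.
Qed.

(* Discharging: a vertex of value 2 sends 1 to itself and to both neighbours,
   a vertex of value 1 sends 1 to itself, and every vertex receives at least 1. *)
Lemma roman_dom_weight f : roman_dom f -> (2 * p.+3 <= 3 * \sum_i f i)%N.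
Proof.
move=> fP.
pose two i : nat := f i == 2%N.
have le1 i : (1 <= (0 < f i) + (two (i + 1)%R + two (i - 1)%R))%N.
  by rewrite /two; case: (posnP (f i)) => [/fP[] ->|_]; rewrite ?eqxx ?addn1.
have : (\sum_(i : Z) 1 <= \sum_i ((0 < f i) + (two (i + 1)%R + two (i - 1)%R)))%N.
  exact: leq_sum.
rewrite sum1_card card_ord !big_split /=.
have -> : (\sum_(i : Z) two (i + 1)%R = \sum_i two i)%N.
  by rewrite [RHS](reindex_inj (addIr 1)).
have -> : (\sum_(i : Z) two (i - 1)%R = \sum_i two i)%N.
  by rewrite [RHS](reindex_inj (addIr (- 1))).
(* Vertex by vertex: value 2 sends out 3, value 1 sends out 1, at most 3/2 per unit of value in both
   cases. *)
have : (2 * \sum_(i : Z) (0 < f i) + 4 * \sum_i two i <= 3 * \sum_i f i)%N.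
  rewrite !big_distrr -big_split /=; apply: leq_sum => i _; rewrite /two.
  by case: (f i) => [|[|[|m]]] //=; lia.
move: (\sum_i f i)%N (\sum_i two i)%N (\sum_(i < p.+3) (0 < f i))%N => x y z; lia.
Qed.

End CyclicIndices.

(** * Dominating words and their weighted sums *)

(* The word (0 2 0)^k a b. *)
Definition roman_word (k a b i : nat) : nat :=
  if (i < 3 * k)%N then if (i %% 3 == 1)%N then 2 else 0
  else if i == (3 * k)%N then a else b.

Lemma roman_word_le2 k a b i :
  (a <= 2)%N -> (b <= 2)%N -> (roman_word k a b i <= 2)%N.
Proof. by rewrite /roman_word; do 2?case: ifP => // _; case: ifP. Qed.

(** Each block 0 2 0 dominates itself, so only the tail matters: a 0 in it needs a 2 as its partner.
    For [l = 1] the letter [b] lies beyond the last index. *)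
Lemma roman_dom_word (p k l a b : nat) : p.+3 = (3 * k + l)%N ->
    (a == 0%N) ==> (l == 2%N) && (b == 2%N) ->
    (l == 1%N) || (l == 2%N) && ((b == 0%N) ==> (a == 2%N)) ->
  roman_dom (fun i : 'I_p.+3 => roman_word k a b i).
Proof.
move=> pE aP bP i; have lti := ltn_ord i; cbv beta.
have [i3|i3] := ltnP i (3 * k).
  rewrite {1}/roman_word i3; case: eqP => // i1 _.
  have [i0|i2] : (i %% 3 = 0 \/ i %% 3 = 2)%N by lia.
    left; rewrite val_add1; last by lia.
    by rewrite /roman_word !ifT //; lia.
  right; rewrite val_sub1; last by lia.
  by rewrite /roman_word !ifT //; lia.
have -> : roman_word k a b i = if i == (3 * k)%N :> nat then a else b.
  by rewrite /roman_word ltnNge i3.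
case: eqP => [iE a0|iE b0].
  move: aP; rewrite a0 => /andP[/eqP lE /eqP bE].
  left; rewrite val_add1; last by lia.
  by rewrite /roman_word !ifF //; lia.
right; rewrite val_sub1; last by lia.
have -> : (i.-1 = 3 * k)%N by lia.
by rewrite /roman_word ltnn eqxx; lia.
Qed.

Section WordSums.
Variables (A : pzSemiRingType) (k a b : nat).

Lemma sum_roman_word1 (F : nat -> A) :
  \sum_(0 <= t < 3 * k + 1) (roman_word k a b t)%:R * F t
    = (\sum_(0 <= t < k) F (3 * t + 1)%N) *+ 2 + a%:R * F (3 * k)%N.
Proof.
rewrite addn1 big_nat_recr //= {2}/roman_word ltnn eqxx; congr (_ + _).
transitivity (\sum_(0 <= t < 3 * k) (if (t %% 3 == 1)%N then 2 else 0)%:R * F t).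
  by apply: eq_big_nat => t /andP[_ tk]; rewrite /roman_word tk.
elim: {1 2}k => [|m IHm]; first by rewrite muln0 !big_geq ?mul0rn.
rewrite mulnS addnC !addnS addn0 !big_nat_recr //= IHm mulrnDl.
have [-> [-> ->]] : [/\ (3 * m) %% 3 = 0, (3 * m).+1 %% 3 = 1 & (3 * m).+2 %% 3 = 2]%N.
  by split; lia.
by rewrite /= !mul0r !addr0 addn1 mulr_natl.
Qed.

Lemma sum_roman_word2 (F : nat -> A) :
  \sum_(0 <= t < 3 * k + 2) (roman_word k a b t)%:R * F t
    = (\sum_(0 <= t < k) F (3 * t + 1)%N) *+ 2
      + a%:R * F (3 * k)%N + b%:R * F (3 * k).+1.
Proof.
rewrite addn2 big_nat_recr //= -addn1 sum_roman_word1; congr (_ + _ * _).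
by rewrite /roman_word !ifF //; lia.
Qed.

End WordSums.

(** A tail adding up to [l] makes the total 2k + l = n - k. *)
Lemma sum_roman_word p k l a b : p.+3 = (3 * k + l)%N -> l = 1%N \/ l = 2%N ->
  (\sum_(i < p.+3) roman_word k a b i = 2 * k + (a + (if l == 2 then b else 0)))%N.
Proof.
move=> pE lP; rewrite -(big_mkord xpredT (roman_word k a b)) pE.
have sum1 m : (\sum_(0 <= t < m) roman_word k a b t
              = \sum_(0 <= t < m) (roman_word k a b t)%:R * 1 :> nat).
  by apply: eq_bigr => t _; rewrite mulr1 natn.
case: lP => ->; rewrite {}sum1 ?(sum_roman_word1, sum_roman_word2) !mulr1 !natn;
  by rewrite sum_nat_const_nat /=; lia.
Qed.

(** * Averaging over rotations *)

Section Averaging.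
Variables (R : realFieldType) (p : nat) (s : 'I_p.+3 -> R) (gamma : R).
Local Notation Z := 'I_p.+3.

(** Over all rotations each value of [f] meets each value of [s] exactly once. *)
Lemma sum_rotations (f : Z -> nat) :
  \sum_j \sum_i (f i)%:R * s (i + j) = (\sum_i f i)%N%:R * \sum_i s i.
Proof.
rewrite exchange_big natr_sum mulr_suml; apply: eq_bigr => i _.
by rewrite -mulr_sumr [in RHS](reindex_inj (addrI i)).
Qed.

Hypothesis gamma_le : forall f : Z -> nat, roman_dom f ->
  (forall i, f i <= 2)%N -> gamma <= \sum_i (f i)%:R * s i.

Variable f : Z -> nat.
Hypotheses (f_dom : roman_dom f) (f_le2 : forall i, (f i <= 2)%N).

Lemma rotation_ge j : gamma <= \sum_i (f i)%:R * s (i + j).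
Proof.
have := gamma_le (@roman_dom_shift _ _ j f_dom) (fun i => f_le2 _).
rewrite (reindex_inj (addIr j)) => /le_trans; apply.
by apply: ler_sum => i _; rewrite addrK.
Qed.

Lemma average_ge : p.+3%:R * gamma <= (\sum_i f i)%N%:R * \sum_i s i.
Proof.
rewrite -sum_rotations mulr_natl -{1}[p.+3]card_ord -sumr_const.
by apply: ler_sum => j _; apply: rotation_ge.
Qed.

(** The excesses of the rotations over [gamma] are nonnegative and sum to zero. *)
Lemma average_eq : p.+3%:R * gamma = (\sum_i f i)%N%:R * \sum_i s i ->
  forall j, \sum_i (f i)%:R * s (i + j) = gamma.
Proof.
move=> E j; apply/eqP; rewrite -subr_eq0; apply/eqP; move: j (erefl true).
have: \sum_j (\sum_i (f i)%:R * s (i + j) - gamma) == 0.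
  by rewrite sumrB sum_rotations -E sumr_const card_ord mulr_natl subrr.
rewrite psumr_eq0 => [/allP h j _|j _]; last by rewrite subr_ge0 rotation_ge.
by apply/eqP/h; rewrite mem_index_enum.
Qed.

End Averaging.

(** * Equal rotations force a constant [s] *)

Section Constancy.
Variables (R : realFieldType) (p k l : nat) (s : 'I_p.+3 -> R) (gamma : R).
Local Notation Z := 'I_p.+3.
Hypothesis pE : p.+3 = (3 * k + l)%N.

(* The rotations of (0 2 0)^k 1 by j and by j + 3 agree but for four entries. *)
Lemma word_rotations_recurrence : l = 1%N ->
    (forall j : Z, \sum_(i : Z) (roman_word k 1 1 i)%:R * s (i + j) = gamma) ->
  forall j : Z, s (j + 3%:R) - 2 * s (j + 2%:R) + 2 * s (j + 1) - s j = 0.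
Proof.
move=> l1 rotE j; have pE1 : (3 * k + 1 = p.+3)%N by rewrite pE l1.
have eq_sum m : (\sum_(0 <= t < k) s ((3 * t + 1)%:R + m)) *+ 2
                + s ((3 * k)%:R + m) = gamma.
  rewrite -(rotE m) -[s ((3 * k)%:R + m)]mul1r.
  rewrite -(sum_roman_word1 k 1 1 (fun t => s (t%:R + m))) pE1 big_mkord.
  by apply: eq_bigr => i _; rewrite natr_Zp.
have k3 : (3 * k)%:R = -1 :> Z.
  by apply/(addIr 1); rewrite addNr -[1]/(1%:R) -natrD pE1 cycle_natr.
(* Since 3k = -1 in Z/n, these shifts put the final 1 on j + 3 and on j; the sums over the 2s differ
   by a telescoping sum, which leaves j + 1 and j + 2. *)
have := eq_sum (j + 4%:R); rewrite -(eq_sum (j + 1)).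
have -> : \sum_(0 <= t < k) s ((3 * t + 1)%:R + (j + 4%:R))
    = \sum_(0 <= t < k) s ((3 * t + 1)%:R + (j + 1)) - s (j + 2%:R) + s (j + 1).
  rewrite -addrA addrC; apply/eqP; rewrite -subr_eq; apply/eqP.
  have F t : s ((3 * t + 1)%:R + (j + 1)) = s ((3 * t)%:R + (j + 2%:R)).
    by rewrite natrD; congr s; ring.
  have G t : s ((3 * t + 1)%:R + (j + 4%:R)) = s ((3 * t.+1)%:R + (j + 2%:R)).
    by rewrite mulnS !natrD; congr s; ring.
  under eq_bigr do rewrite G; under [X in _ - X]eq_bigr do rewrite F.
  rewrite -sumrB (telescope_sumr (fun t => s ((3 * t)%:R + (j + 2%:R)))) //.
  by rewrite k3 muln0 add0r [RHS]addrC; have -> : -1 + (j + 2%:R) = j + 1 by ring.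
rewrite k3.
have -> : -1 + (j + 4%:R) = j + 3%:R by ring.
have -> : -1 + (j + 1) = j by ring.
move: (\sum_(0 <= t < k) _) => x; lra.
Qed.

(** The characteristic polynomial is (x - 1)(x^2 - x + 1), so the differences [d] change sign after
    3 steps. As 3k = -1 in Z/n, consecutive differences agree up to the sign (-1)^k, and [d2] then
    makes them vanish. *)
Lemma recurrence_const : l = 1%N ->
    (forall j : Z, s (j + 3%:R) - 2 * s (j + 2%:R) + 2 * s (j + 1) - s j = 0) ->
  forall j : Z, s (j + 1) = s j.
Proof.
move=> l1 rec j; have pE1 : (3 * k + 1 = p.+3)%N by rewrite pE l1.
pose d i := s (i + 1) - s i.
have d2 i : d (i + 1 + 1) = d (i + 1) - d i.
  rewrite /d; have := rec i.
  have -> : i + 3%:R = i + 1 + 1 + 1 by ring.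
  have -> : i + 2%:R = i + 1 + 1 by ring.
  lra.
have d3 i t : d (i + (3 * t)%:R) = (-1) ^+ t * d i.
  elim: t i => [|t IHt] i; first by rewrite muln0 addr0 mul1r.
  have -> : i + (3 * t.+1)%:R = i + 1 + 1 + 1 + (3 * t)%:R.
    by rewrite mulnS natrD; ring.
  by rewrite IHt !d2 exprSr; ring.
have k3 : (3 * k)%:R = -1 :> Z.
  by apply/(addIr 1); rewrite addNr -[1]/(1%:R) -natrD pE1 cycle_natr.
have dN i : d i = (-1) ^+ k * d (i + 1) by rewrite -d3 k3 addrK.
have := d2 j; have := dN j; have := dN (j + 1).
rewrite -signr_odd; case: (odd k); rewrite ?expr0 ?expr1 /d; lra.
Qed.

(* For l = 2, replacing the end 2 0 by 0 2 moves a single value. *)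
Lemma word_rotations_const2 : l = 2%N ->
    (forall j : Z, \sum_(i : Z) (roman_word k 2 0 i)%:R * s (i + j) = gamma) ->
    (forall j : Z, \sum_(i : Z) (roman_word k 0 2 i)%:R * s (i + j) = gamma) ->
  forall j : Z, s (j + 1) = s j.
Proof.
move=> l2 rot20 rot02 j; have pE2 : (3 * k + 2 = p.+3)%N by rewrite pE l2.
have eq_sum a b m : \sum_(i : Z) (roman_word k a b i)%:R * s (i + m)
    = (\sum_(0 <= t < k) s ((3 * t + 1)%:R + m)) *+ 2
      + a%:R * s ((3 * k)%:R + m) + b%:R * s ((3 * k).+1%:R + m).
  rewrite -(sum_roman_word2 k a b (fun t => s (t%:R + m))) pE2 big_mkord.
  by apply: eq_bigr => i _; rewrite natr_Zp.
(* This shift puts the tail, where the two words differ, on j and j + 1. *)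
have := rot20 (j - (3 * k)%:R); rewrite -(rot02 (j - (3 * k)%:R)) !eq_sum.
have -> : (3 * k)%:R + (j - (3 * k)%:R) = j by rewrite addrC subrK.
have -> : (3 * k).+1%:R + (j - (3 * k)%:R) = j + 1.
  by rewrite -natr1 addrC addrA subrK.
lra.
Qed.

End Constancy.

(** * Edges, cuts and path strength *)

Section Cuts.
Variables (R : realFieldType) (V : finType) (G : fuzzyGraph R V).

Lemma mem_edges x y : ([set x; y] \in edges G) = (x != y) && (0 < fg_mu G x y).
Proof.
rewrite inE; apply/existsP/andP => [[a /existsP[b /and3P[ab mab /eqP E]]]|[xy mxy]].
  rewrite -(edge_weightE G) E edge_weightE; split=> //.
  apply: contraNneq ab => xy; move: E; rewrite xy setUid => E.
  have : (a \in [set y]) && (b \in [set y]) by rewrite E !inE !eqxx orbT.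
  by rewrite !inE => /andP[/eqP-> /eqP->].
by exists x; apply/existsP; exists y; rewrite xy mxy eqxx.
Qed.

(** The path must cross the cut somewhere, and its strength is a minimum over its edges; this bounds
    [conn] from above. *)
Lemma strength_cut (P : pred V) x q :
    path (fun a b => 0 < fg_mu G a b) x q -> P x != P (last x q) ->
  exists a b, [/\ 0 < fg_mu G a b, P a != P b & strength G x q <= fg_mu G a b].
Proof.
elim: q x => [|y q IHq] x /=; first by rewrite eqxx.
case/andP=> mxy yq Pxq; rewrite /strength /= big_cons.
have [Pxy|Pxy] := eqVneq (P x) (P y); last by exists x, y; rewrite ge_min lexx.
have [|a [b [mab Pab le_ab]]] := IHq y yq; first by rewrite -Pxy.
by exists a, b; split=> //; rewrite ge_min le_ab orbT.
Qed.

Lemma le_conn x y : x != y -> 0 < fg_mu G x y -> fg_mu G x y <= conn G x y.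
Proof.
move=> xy mxy; have := @conn_ub _ _ G x y [:: y].
(* The default 1 of the minimum is harmless, as weights are at most 1. *)
rewrite /strength /= big_cons big_nil min_l; last by case/andP: (fg_mu01 G x y).
apply; by rewrite /fg_path /= mxy inE xy eqxx.
Qed.

End Cuts.

(** * Fuzzy cycles with at least two lightest edges *)

Section FuzzyCycle.
Variables (R : realFieldType) (V : finType) (G : fuzzyGraph R V) (p : nat).
Variable u : 'I_p.+3 -> V.
Local Notation Z := 'I_p.+3.
Hypotheses (hC : fuzzy_cycle G u) (hmin : (2 <= #|min_weight_edges G|)%N).
Local Notation w := (fun i : Z => fg_mu G (u i) (u (i + 1))).
Local Notation E := (fun i : Z => [set u i; u (i + 1)]).

Lemma cycle_bij : bijective u. Proof. by case: hC. Qed.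

Lemma cycle_inj : injective u. Proof. exact: bij_inj cycle_bij. Qed.

Lemma cycle_edges : edges G = [set E i | i : Z].
Proof. by case: hC => _ _ ->; apply: eq_imset => i; rewrite ordS_add1. Qed.

Lemma cycle_edge_mem i : E i \in edges G.
Proof. by rewrite cycle_edges; apply/imsetP; exists i. Qed.

Lemma add1_neq (i : Z) : i != i + 1.
Proof.
by rewrite -subr_eq0 opprD addNKr oppr_eq0; apply/eqP => /(congr1 val).
Qed.

(** Relies on n >= 3: two indices with the same edge would give 2 = 0 in Z/n. *)
Lemma cycle_edge_inj : injective E.
Proof.
move=> i j eqE; have : (u i \in E j) && (u (i + 1) \in E j).
  by rewrite -eqE !inE !eqxx orbT.
rewrite !inE !(inj_eq cycle_inj) => /andP[/orP[/eqP//|/eqP ->]] /orP[]/eqP.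
  by rewrite -addrA => /(canRL (addKr j)) /eqP; rewrite addNr => /eqP /(congr1 val).
by move/addIr/eqP; rewrite eq_sym (negPf (add1_neq j)).
Qed.

Lemma cycle_weight_gt0 i : 0 < w i.
Proof.
by have := cycle_edge_mem i; rewrite mem_edges => /andP[].
Qed.

Lemma cycle_adjacent i j : 0 < fg_mu G (u i) (u j) -> j = i + 1 \/ i = j + 1.
Proof.
move=> mij; have ij : u i != u j.
  by apply: contraTneq mij => ->; rewrite fg_mu_diag ltxx.
have : [set u i; u j] \in edges G by rewrite mem_edges ij.
rewrite cycle_edges => /imsetP[t _ eqE].
have : (u i \in E t) && (u j \in E t) by rewrite -eqE !inE !eqxx orbT.
rewrite !inE !(inj_eq cycle_inj).
case/andP=> /orP[]/eqP iE /orP[]/eqP jE; move: ij; rewrite iE jE ?eqxx //; auto.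
Qed.

(* One of the two arcs left when the edges i and j are removed, chosen so that
   the wrap-around edge never needs a special case: vertex 0 is outside it. *)
Definition arc (i j t : Z) : bool := (minn i j < t <= maxn i j)%N.

Lemma arc_cut i j t : arc i j t != arc i j (t + 1) -> t = i \/ t = j.
Proof.
have lti := ltn_ord i; have ltj := ltn_ord j; have ltt := ltn_ord t.
rewrite /arc val_add1_if => cut.
have [tE|tE] : (t = i :> nat \/ t = j :> nat)%N by move: cut; case: ifP; lia.
  by left; apply: ord_inj.
by right; apply: ord_inj.
Qed.

Lemma arc_ends i j : i != j -> arc i j i != arc i j (i + 1).
Proof.
move=> ij; have : (i <> j :> nat) by move/ord_inj/eqP; rewrite (negPf ij).
have lti := ltn_ord i; have ltj := ltn_ord j.
by rewrite /arc val_add1_if; case: ifP; lia.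
Qed.

(** The hypothesis of two lightest edges enters here: one of them survives the removal of edge i. *)
Lemma min_edge_avoiding i : exists2 j, i != j & forall t, w j <= w t.
Proof.
have [e emin ei] : exists2 e, e \in min_weight_edges G & e != E i.
  have : (0 < #|min_weight_edges G :\ E i|)%N.
    by move: hmin; rewrite (cardsD1 (E i)); case: (_ \in _); rewrite ?add0n => // /ltnW.
  by case/card_gt0P=> e; rewrite in_setD1 => /andP[? ?]; exists e.
move: emin; rewrite inE => /andP[]; rewrite {1}cycle_edges => /imsetP[j _ eE] /forallP emin.
exists j; first by apply: contraNneq ei => ->; rewrite eE.
move=> t; have := emin (E t).
by rewrite eE !edge_weightE cycle_edge_mem; apply.
Qed.

(** Removing the edge xy and another lightest edge separates x from y, so every path between them
    uses one of the two, and neither is heavier than xy. *)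
Lemma cycle_conn_le x y : 0 < fg_mu G x y -> conn G x y <= fg_mu G x y.
Proof.
move=> mxy; have [c0|cxy] := leP (conn G x y) 0; first exact: le_trans c0 (ltW mxy).
have [q /and3P[pq _ /eqP lq] <-] := conn_attained cxy.
have [g ug gu] := cycle_bij.
(* Hides the orientation of the edge: only its index and the fact that a cut at i separates x from y
   are kept. *)
have [i [mE sides]] : exists i, fg_mu G x y = w i /\
    forall P : pred Z, P i != P (i + 1) -> P (g x) != P (g y).
  move: mxy; rewrite -[x]gu -[y]gu !ug => /cycle_adjacent[->|->].
    by exists (g x).
  by exists (g y); rewrite fg_mu_sym; split=> // P; rewrite eq_sym.
have [j ij jmin] := min_edge_avoiding i.
have [|a [b [mab]]] := @strength_cut _ _ G (arc i j \o g) _ _ pq.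
  by rewrite lq /=; apply: sides; apply: arc_ends.
have le_w t : arc i j t != arc i j (t + 1) -> w t <= w i.
  by move/arc_cut=> [] ->.
rewrite mE; move: mab; rewrite -[a]gu -[b]gu /= !ug.
case/cycle_adjacent=> ->; last rewrite fg_mu_sym eq_sym.
  by move=> cut /le_trans; apply; apply: le_w.
by move=> cut /le_trans; apply; apply: le_w.
Qed.

Lemma cycle_strong x y : strong G x y = (0 < fg_mu G x y).
Proof.
rewrite /strong; case: ltP => //= mxy; apply/eqP/le_anti.
rewrite cycle_conn_le // andbT le_conn //.
by apply: contraTneq mxy => ->; rewrite fg_mu_diag ltxx.
Qed.

Lemma strong_edges_cycle : strong_edges G = edges G.
Proof.
apply/setP => e; rewrite !inE; apply: eq_existsb => x; apply: eq_existsb => y.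
rewrite cycle_strong; have [->|//] := eqVneq x y.
by rewrite fg_mu_diag ltxx.
Qed.

Lemma mu_min_le i : mu_min G <= w i.
Proof.
rewrite -[leRHS](edge_weightE G); apply: bigmin_le_cond.
by rewrite strong_edges_cycle cycle_edge_mem.
Qed.

Lemma mu_max_ge i : w i <= mu_max G.
Proof.
rewrite -[leLHS](edge_weightE G); apply: le_bigmax_cond.
by rewrite strong_edges_cycle cycle_edge_mem.
Qed.

Lemma mu_min_attained : exists i, w i = mu_min G.
Proof.
have [j _ jmin] := min_edge_avoiding 0; exists j; apply/le_anti.
rewrite mu_min_le andbT; apply: le_bigmin => [|e].
  by case/andP: (fg_mu01 G (u j) (u (j + 1))).
by rewrite strong_edges_cycle cycle_edges => /imsetP[t _ ->]; rewrite edge_weightE.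
Qed.

Lemma mu_max_attained : exists i, w i = mu_max G.
Proof.
case: (@arg_maxP _ _ _ (0 : Z) xpredT w isT) => j _ jmax; exists j; apply/le_anti.
rewrite mu_max_ge /=; apply: bigmax_le => [|e].
  exact: ltW (cycle_weight_gt0 j).
rewrite strong_edges_cycle cycle_edges => /imsetP[t _ ->]; rewrite edge_weightE.
exact: jmax.
Qed.

Lemma strong_nbrs_cycle i : strong_nbrs G (u i) = [set u (i + 1); u (i - 1)].
Proof.
have [g ug gu] := cycle_bij; apply/setP => y; rewrite !inE cycle_strong.
apply/idP/orP => [|[]/eqP ->]; last 2 first.
- exact: cycle_weight_gt0.
- by have := cycle_weight_gt0 (i - 1); rewrite subrK fg_mu_sym.
rewrite -[y]gu => /cycle_adjacent[->|->]; first by left.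
by rewrite addrK; right.
Qed.

Lemma mu_s_cycle i : mu_s G (u i) = Num.min (w i) (w (i - 1)).
Proof.
have w1 j : w j <= 1 by case/andP: (fg_mu01 G (u j) (u (j + 1))).
rewrite /mu_s strong_nbrs_cycle; apply/le_anti/andP; split.
  rewrite le_min; apply/andP; split; first by apply: bigmin_le_cond; rewrite !inE eqxx.
  rewrite /= subrK fg_mu_sym.
  by apply: bigmin_le_cond; rewrite !inE eqxx orbT.
apply: le_bigmin => [|y]; first by rewrite ge_min w1.
rewrite !inE => /orP[]/eqP ->; first by rewrite ge_min lexx.
by rewrite /= subrK [X in Num.min _ X]fg_mu_sym ge_min lexx orbT.
Qed.

Lemma size_cycle : fg_size G = \sum_i w i.
Proof.
rewrite /fg_size cycle_edges big_imset /=; last by move=> i j _ _; apply: cycle_edge_inj.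
by apply: eq_bigr => i _; rewrite edge_weightE.
Qed.

Lemma card_cycle_edges (P : pred R) :
  #|[set e in edges G | P (edge_weight G e)]| = #|[set i : Z | P (w i)]|.
Proof.
rewrite -(card_imset _ cycle_edge_inj); apply: eq_card => e; rewrite inE cycle_edges.
apply/andP/imsetP => [[/imsetP[i _ ->]]|[i]].
  by rewrite edge_weightE => Pi; exists i; rewrite // inE.
by rewrite inE => Pi ->; rewrite -cycle_edges cycle_edge_mem edge_weightE.
Qed.

Lemma snrdf_cycle (f : {ffun V -> 'I_3}) :
  reflect (roman_dom (fun i => f (u i) : nat)) (snrdf G f).
Proof.
apply: (iffP forallP) => [fP i fi|fP x].
  have := fP (u i); rewrite fi => /exists_inP[y]; rewrite strong_nbrs_cycle !inE.
  by case/orP=> /eqP -> /eqP ->; [left|right].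
have [g ug gu] := cycle_bij; apply/implyP => /eqP; rewrite -[x]gu => fx; apply/exists_inP.
by case: (fP _ fx) => /eqP f2; [exists (u (g x + 1))|exists (u (g x - 1))];
  rewrite // strong_nbrs_cycle !inE eqxx ?orbT.
Qed.

Lemma snrdf_weight_cycle (f : {ffun V -> 'I_3}) :
  snrdf_weight G f = \sum_i (f (u i))%:R * mu_s G (u i).
Proof. by rewrite /snrdf_weight (reindex u) //; apply: onW_bij cycle_bij. Qed.

Lemma gamma_cycle_le (f : Z -> nat) : roman_dom f -> (forall i, f i <= 2)%N ->
  gamma_snR G <= \sum_i (f i)%:R * mu_s G (u i).
Proof.
move=> fdom f2; have [g ug gu] := cycle_bij.
(* [inord] preserves the values because they are at most 2. *)
pose F := [ffun x => inord (f (g x)) : 'I_3].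
have FE i : F (u i) = f i :> nat by rewrite ffunE ug inordK // ltnS.
rewrite /gamma_snR; case: arg_minP => [|h _ hmin']; first exact: snrdf_const2.
have /hmin' : snrdf G F.
  by apply/snrdf_cycle => i; rewrite !FE => /fdom.
rewrite (snrdf_weight_cycle F) => /le_trans; apply.
by apply: ler_sum => i _; rewrite FE.
Qed.

Lemma gamma_cycle_attained : exists2 f : Z -> nat, roman_dom f &
  gamma_snR G = \sum_i (f i)%:R * mu_s G (u i).
Proof.
rewrite /gamma_snR; case: arg_minP => [|h hdom _]; first exact: snrdf_const2.
by exists (fun i => h (u i) : nat); [apply/snrdf_cycle|apply: snrdf_weight_cycle].
Qed.

End FuzzyCycle.

(** * The bound on the sum of [mu_s], and the equivalence *)

(** The deficit w i - min (w i) (w (i - 1)) is the positive part of the step into i; going round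
    from a to b, these parts add up to at least w b - w a. *)
Lemma sum_min_neighbors_le (R : realFieldType) p (w : 'I_p.+3 -> R) a b :
  \sum_i Num.min (w i) (w (i - 1)) <= \sum_i w i - (w b - w a).
Proof.
rewrite lerBrDl -lerBrDr -sumrB (reindex_inj (addIr (a + 1))) /=.
have step_ge0 c d : 0 <= d - Num.min d c :> R by rewrite subr_ge0 ge_min lexx.
rewrite sum_natr -(@subrK _ a b) -[b - a]natr_Zp.
set r := nat_of_ord (b - a); have ltr : (r <= p.+3)%N := ltnW (ltn_ord (b - a)).
(* Only the r steps from a to b are kept; the others are nonnegative. *)
rewrite (big_cat_nat (leq0n r) ltr) /=; apply: ler_wpDr; first by apply: sumr_ge0.
have -> : w (r%:R + a) - w a = \sum_(0 <= t < r) (w (t.+1%:R + a) - w (t%:R + a)).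
  by rewrite (telescope_sumr (fun t => w (t%:R + a))) // add0r.
apply: ler_sum => t _.
have -> : t%:R + (a + 1) = t.+1%:R + a by rewrite -natr1; ring.
have -> : t.+1%:R + a - 1 = t%:R + a by rewrite -natr1; ring.
by rewrite lerB // ge_min lexx orbT.
Qed.

Theorem theorem4p5 (R : realFieldType) (n k l : nat)
    (hn : (1 <= n)%N) (hk : (1 <= k)%N) (hl : l = 1%N \/ l = 2%N)
    (hnkl : n = (3 * k + l)%N)
    (V : finType) (G : fuzzyGraph R V) (u : 'I_n -> V)
    (hC : fuzzy_cycle G u)
    (hmin : (2 <= #|min_weight_edges G|)%N) :
  gamma_snR G
    = (1 - k%:R / n%:R) * (fg_size G - (mu_max G - mu_min G))
  <->
  [/\ (n - 1 <= #|[set e in edges G | edge_weight G e == mu_min G]|)%N,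
      (#|[set e in edges G | (edge_weight G e != mu_min G)
                             && (edge_weight G e == mu_max G)]| <= 1)%N
    & forall e, e \in edges G ->
        edge_weight G e = mu_min G \/ edge_weight G e = mu_max G].
Proof.
have n3 : (3 <= n)%N by case: hC.
case: n n3 hnkl u hC {hn} => [|[|[|p]]] // _ pE u hC.
pose w (i : 'I_p.+3) := fg_mu G (u i) (u (i + 1)).
pose s i := mu_s G (u i).
set m := mu_min G; set M := mu_max G; set gamma := gamma_snR G.
have m_le i : m <= w i := mu_min_le hC hmin i.
have [a wa] : exists a, w a = m := mu_min_attained hC hmin.
have [b wb] : exists b, w b = M := mu_max_attained hC hmin.
have sE i : s i = Num.min (w i) (w (i - 1)) := mu_s_cycle hC hmin i.
have m_gt0 : 0 < m by rewrite -wa; apply: cycle_weight_gt0.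
have sizeE : fg_size G = \sum_i w i := size_cycle hC.
have gamma_le f := @gamma_cycle_le _ _ _ _ _ hC hmin f.
have cE : 1 - k%:R / p.+3%:R = (2 * k + l)%:R / p.+3%:R :> R.
  have N0 : p.+3%:R != 0 :> R by rewrite pnatr_eq0.
  apply: (mulIf N0); rewrite mulrBl !divfK // mul1r pE.
  by ring.
have sum_s_le : \sum_i s i <= \sum_i w i - (M - m).
  rewrite -wb -wa (eq_bigr _ (fun i _ => sE i)); exact: sum_min_neighbors_le.
have word_dom (c d : nat) : (c == 0%N) ==> (l == 2%N) && (d == 2%N) ->
    (l == 1%N) || (l == 2%N) && ((d == 0%N) ==> (c == 2%N)) ->
    roman_dom (fun i : 'I_p.+3 => roman_word k c d i).
  exact: roman_dom_word.
have word11 : roman_dom (fun i : 'I_p.+3 => roman_word k 1 1 i).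
  by apply: word_dom => //; case: hl => ->.
have word11_le2 (i : 'I_p.+3) : (roman_word k 1 1 i <= 2)%N.
  exact: roman_word_le2.
have word11_sum : (\sum_(i < p.+3) roman_word k 1 1 i = 2 * k + l)%N.
  by rewrite (sum_roman_word _ _ pE hl); case: hl => ->.
have c_gt0 : 0 < (2 * k + l)%:R :> R by rewrite ltr0n; lia.
have avg := average_ge gamma_le word11 word11_le2; rewrite word11_sum in avg.
have N_gt0 : 0 < p.+3%:R :> R by rewrite ltr0n.
rewrite cE sizeE.
(* The pivot is a condition on indexed weights; its equivalence with the edge counts comes first. *)
transitivity (exists b, w b = M /\ forall i, i != b -> w i = m); last first.
  have card_w P := card_cycle_edges hC P.
  rewrite (card_w (fun x => x == m)) (card_w (fun x => (x != m) && (x == M))).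
  rewrite -/w subn1 /=; split=> [[c [wc wm]]|[cardm _ wmM]].
    split.
    - rewrite -ltnS -[X in (X <= _)%N](card_ord p.+3) -cardsT.
      rewrite (cardsD1 c) in_setT ltnS; apply/subset_leq_card/subsetP => i.
      by rewrite !inE andbT => /wm/eqP.
    - rewrite -(cards1 c); apply/subset_leq_card/subsetP => i; rewrite !inE.
      by case/andP=> + _; apply: contraR => /wm/eqP.
    - move=> e; rewrite (cycle_edges hC) => /imsetP[i _ ->].
      rewrite edge_weightE -/(w i).
      by have [->|/wm] := eqVneq i c; [right|left].
  have /card_le1_eqP unique : (#|~: [set i | w i == m]| <= 1)%N.
    by rewrite cardsCs setCK card_ord leq_subLR addn1 ltnS.
  (* The exceptional edge is the one not of weight [m]; if there is none, any heaviest edge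
     serves. *)
  have [none|[c]] := set_0Vmem (~: [set i | w i == m]).
    exists b; split=> // i _; apply/eqP; apply: contraFT (in_set0 i).
    by rewrite -none !inE.
  rewrite !inE => wc; exists c; split=> [|i].
    have := wmM _ (cycle_edge_mem hC c); rewrite edge_weightE -/(w c).
    by case=> // /eqP; rewrite (negPf wc).
  move=> ic; apply/eqP; apply: contraNT ic => wi.
  by apply/eqP/unique; rewrite !inE.
split=> [gammaE|[c [wc wm]]].
  have NgammaE : p.+3%:R * gamma = (2 * k + l)%:R * (\sum_i w i - (M - m)).
    by rewrite gammaE mulrA mulrCA divff ?mulr1 // gt_eqF.
  (* The assumed value of [gamma] turns both inequalities, [avg] and [sum_s_le], into equalities. *)
  have sum_sE : \sum_i s i = \sum_i w i - (M - m).
    by apply/le_anti; rewrite sum_s_le -(ler_pM2l c_gt0) -NgammaE.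
  rewrite -sum_sE in NgammaE.
  have rotE (c d : nat) : (c <= 2)%N -> (d <= 2)%N ->
      (c == 0%N) ==> (l == 2%N) && (d == 2%N) ->
      (l == 1%N) || (l == 2%N) && ((d == 0%N) ==> (c == 2%N)) ->
      (c + (if l == 2%N then d else 0) = l)%N ->
    forall j, \sum_(i < p.+3) (roman_word k c d i)%:R * s (i + j) = gamma.
    move=> c2 d2 cP dP cdE; apply: (average_eq gamma_le (word_dom c d cP dP)).
      by move=> i; apply: roman_word_le2.
    by rewrite (sum_roman_word _ _ pE hl) cdE.
  have s_step j : s (j + 1) = s j.
    case: (hl) => lE.
      apply: (recurrence_const pE lE); apply: (word_rotations_recurrence pE lE).
      by apply: rotE; rewrite ?lE.
    by apply: (word_rotations_const2 pE lE); apply: rotE; rewrite ?lE.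
  (* The constant is read off at [a], an end of a lightest edge. *)
  have sm i : s i = m.
    by rewrite (cycle_const s_step i a) sE wa min_l.
  exists b; split=> // i ib.
  have: \sum_(i | i != b) (w i - m) == 0.
    move: sum_sE; rewrite (eq_bigr _ (fun i _ => sm i)).
    rewrite sumrB (bigD1 b) // [\sum_i w i](bigD1 b) //= wb => /eqP.
    by rewrite -subr_eq0 => /eqP h; apply/eqP; lra.
  rewrite psumr_eq0 => [/allP h|j _]; last by rewrite subr_ge0.
  by apply/eqP; have := h i (mem_index_enum i); rewrite ib subr_eq0.
(* Each vertex has two incident edges, at most one of them exceptional. *)
have sm i : s i = m.
  rewrite sE; have [->|ic] := eqVneq i c; last by rewrite wm // min_l.
  rewrite [w (c - 1)]wm ?min_r //; have := add1_neq (c - 1).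
  by rewrite subrK.
have sumE : \sum_i w i - (M - m) = p.+3%:R * m.
  have -> : p.+3%:R * m = \sum_(i < p.+3) m by rewrite sumr_const card_ord mulr_natl.
  rewrite (bigD1 c) //= [RHS](bigD1 c) //= (eq_bigr _ wm) wc; lra.
have sum_m (f : 'I_p.+3 -> R) : \sum_i f i * s i = (\sum_i f i) * m.
  by rewrite mulr_suml; apply: eq_bigr => i _; rewrite sm.
rewrite sumE mulrA divfK ?gt_eqF //; apply/le_anti/andP; split.
  have := gamma_le _ word11 word11_le2.
  by rewrite sum_m -natr_sum word11_sum.
have [f fdom ->] : exists2 f : 'I_p.+3 -> nat, roman_dom f &
    gamma = \sum_i (f i)%:R * s i := gamma_cycle_attained hC hmin.
(* Integrality closes the gap: 2n/3 = 2k + 2l/3 rounds up to 2k + l for both values of [l]. *)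
rewrite sum_m -natr_sum ler_pM2r // ler_nat.
by have := roman_dom_weight fdom; case: hl => lE; lia.
Qed.
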